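(* Let $m$ be an even positive integer, $n$ a positive integer, and let $\mathcal{C}$ and $\mathcal{C}'$ be two order $m$ dimension $n$ symmetric Cauchy tensors with generating vectors $c=(c_1,\ldots,c_n)\in\mathbb{R}^n$ and $c'=(c_1',\ldots,c_n')\in\mathbb{R}^n$ respectively. If $\mathcal{C}$ and $\mathcal{C}'$ are positive definite, then the Hadamard product $\mathcal{C}\circ\mathcal{C}'$ is a positive definite tensor.
   Context: $[n]=\{1,\ldots,n\}$. An order $m$ dimension $n$ symmetric Cauchy tensor with generating vector $c=(c_1,\ldots,c_n)\in\mathbb{R}^n$ is the real tensor $\mathcal{C}=(c_{i_1\cdots i_m})$ with entries $c_{i_1i_2\cdots i_m}=\frac{1}{c_{i_1}+c_{i_2}+\cdots+c_{i_m}}$, $i_1,\ldots,i_m\in[n]$, where it is assumed that $c_{i_1}+\cdots+c_{i_m}\neq 0$ for all $i_1,\ldots,i_m\in[n]$. The Hadamard product of order $m$ dimension $n$ tensors $\mathcal{A}=(a_{i_1\cdots i_m})$ and $\mathcal{B}=(b_{i_1\cdots i_m})$ is the order $m$ dimension $n$ tensor $\mathcal{A}\circ\mathcal{B}=(a_{i_1\cdots i_m}b_{i_1\cdots i_m})$. A tensor $\mathcal{A}$ of order $m$ and dimension $n$ is positive definite if $\mathcal{A}x^m:=\sum_{i_1,\ldots,i_m\in[n]}a_{i_1\cdots i_m}x_{i_1}\cdots x_{i_m}> 0$ for all nonzero $x\in\mathbb{R}^n$. *)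

(* Defs.v *)
From mathcomp Require Import all_boot all_order all_algebra reals.

Set Implicit Arguments.
Unset Strict Implicit.
Unset Printing Implicit Defensive.

Import Order.TTheory GRing.Theory Num.Theory.
Local Open Scope ring_scope.

Notation tensor R m n := {ffun {ffun 'I_m -> 'I_n} -> R}.

Section Tensors.

Variables (R : realType) (m n : nat).

Definition tensor_hadamard (A B : tensor R m n) : tensor R m n :=
  [ffun i => A i * B i].

Definition tensor_form (A : tensor R m n) (x : 'rV[R]_n) : R :=
  \sum_(i : {ffun 'I_m -> 'I_n}) A i * \prod_(k < m) x ord0 (i k).

Definition tensor_posdef (A : tensor R m n) : Prop :=
  forall x : 'rV[R]_n, x != 0 -> 0 < tensor_form A x.

(* The first conjunct is the standing assumption on generating vectors; without
   it, a vanishing denominator would silently give the entry 0^-1 = 0. *)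
Definition is_cauchy_tensor (c : 'rV[R]_n) (C : tensor R m n) : Prop :=
  (forall i : {ffun 'I_m -> 'I_n}, \sum_(k < m) c ord0 (i k) != 0) /\
  (forall i : {ffun 'I_m -> 'I_n}, C i = (\sum_(k < m) c ord0 (i k))^-1).

End Tensors.

(* Main.v *)
Require Import Defs.
From mathcomp Require Import all_boot all_order all_algebra reals.
From mathcomp Require Import boolp classical_sets functions.
From mathcomp Require Import topology normedtype derive realfun sequences exp.

(** Writing [1/s = \int_0^oo exp(-s t) dt] for the denominators [s] of [C'], the
    form of [C \o C'] at [x] becomes the integral over [t > 0] of the form of [C]
    at the vector [(x_j exp(-c'_j t))_j], hence of a positive function. The
    integral is replaced by monotonicity of its tail
    [F t = \sum_i a_i / s_i exp(-s_i t)], which is decreasing with limit 0. *)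

Set Implicit Arguments.
Unset Strict Implicit.
Unset Printing Implicit Defensive.

Import Order.TTheory GRing.Theory Num.Theory.
Import numFieldNormedType.Exports.
Local Open Scope ring_scope.

Section ExponentialSums.

Variables (R : realType) (I : finType) (s : I -> R).

Lemma is_derive_exp_sum (a : I -> R) (t : R) :
  is_derive t (1 : R) (\sum_i (fun u : R => a i * expR (- s i * u)))
    (\sum_i a i * (- s i * expR (- s i * t))).
Proof.
apply: (big_ind2 (fun f d => is_derive t (1 : R) f d)) => [|f df g dg ? ?|i _].
- exact: is_derive_cst.
- exact: is_deriveD.
- have h : is_derive t (1 : R) (fun u : R => - s i * u) (- s i).
    by have := is_deriveZ (- s i) (is_derive_id t 1); rewrite /GRing.scale/= mulr1.
  have e := is_derive1_comp (is_derive_expR (- s i * t)) h.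
  by have := is_deriveZ (a i) e; rewrite [_ * - s i]mulrC.
Qed.

Hypothesis s_gt0 : forall i, 0 < s i.

Lemma cvg_exp_sum (a : I -> R) :
  ((\sum_i (fun u : R => a i * expR (- s i * u))) t @[t --> +oo]
    --> (0 : R))%classic.
Proof.
(* The limit 0 is rewritten as a sum of zeros, so that [big_ind2] can pair the sum of functions with
   the sum of their limits, term by term. *)
have <- : \sum_(i : I) 0 = 0 :> R by rewrite big1.
apply: (big_ind2 (fun (f : R -> R) (l : R) => (f t @[t --> +oo] --> l)%classic)).
- exact: cvg_cst.
- by move=> f l g k; apply: cvgD.
- move=> i _; rewrite -[X in (_ --> X)%classic](mulr0 (a i)); apply: cvgMl_tmp.
  under eq_fun do rewrite mulNr.
  apply: (@cvg_comp _ _ _ (fun t : R => s i * t) (fun t : R => expR (- t)) _ _ _ _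
    (@cvgr_expR R)).
  exact: gt0_cvgMry.
Qed.

(** The conclusion is the hypothesis integrated over [t > 0]. Individual [a i] may be negative, so
    no termwise argument is possible. *)
Lemma sum_div_gt0_of_exp_sum_gt0 (a : I -> R) :
  (forall t, 0 < \sum_i a i * expR (- s i * t)) -> 0 < \sum_i a i / s i.
Proof.
move=> pos; set b := fun i => a i / s i.
pose F := \sum_i (fun u : R => b i * expR (- s i * u)).
(* Differentiation brings down [- s i], which cancels the denominator of [b i]: the derivative of
   [F] is minus the sum in [pos]. *)
have dF t : is_derive t (1 : R) F (- \sum_i a i * expR (- s i * t)).
  rewrite -sumrN; suff -> : \sum_i - (a i * expR (- s i * t)) =
      \sum_i b i * (- s i * expR (- s i * t)) by exact: is_derive_exp_sum.
  by apply: eq_bigr => i _; rewrite mulrA mulrN divfK ?gt_eqF// !mulNr.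
have decF u v : u < v -> F v < F u.
  move=> uv; rewrite -subr_gt0.
  have cF : {within `[u, v], continuous F}%classic.
    apply: continuous_subspaceT => t; apply/differentiable_continuous.
    exact/derivable1_diffP.
  have [t _ e] := MVT uv (fun w _ => dF w) cF.
  by rewrite -opprB e mulNr opprK mulr_gt0 ?pos ?subr_gt0.
(* If [F 1 < 0], the limit 0 would force [F t > F 1] for some [t > 1], against strict decrease. The
   step from 0 to 1 then makes [F 0] strictly positive. *)
have F1 : 0 <= F 1.
  rewrite leNgt; apply/negP => F1.
  have [t t1 Ft] := pinfty_ex_gt (num_real 1) (cvgr_gt _ (@cvg_exp_sum b) _ F1).
  by have := lt_trans Ft (decF _ _ t1); rewrite ltxx.
have := le_lt_trans F1 (decF 0 1 ltr01).
by rewrite /F fct_sumE; under eq_bigr do rewrite mulr0 expR0 mulr1.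
Qed.

End ExponentialSums.

(** At the [j]-th basis vector, every monomial vanishes except the one whose indices all equal
    [j]. *)
Lemma posdef_diag_gt0 (R : realType) (m n : nat) (A : tensor R m n)
  (j : 'I_n) : tensor_posdef A -> 0 < A [ffun=> j].
Proof.
move=> posdefA; have dj0 : delta_mx ord0 j != 0 :> 'rV[R]_n.
  by apply/eqP => /rowP/(_ j)/eqP; rewrite !mxE !eqxx oner_eq0.
have := posdefA _ dj0.
rewrite /tensor_form (bigD1 [ffun=> j])//= [X in _ + X]big1 ?addr0; last first.
  move=> i /eqP ij; have [k ikj] : exists k, i k != j.
    apply/existsP; rewrite -negb_forall; apply/forallP => h; apply: ij.
    by apply/ffunP => k; rewrite ffunE; apply/eqP.
  by rewrite (bigD1 k)//= !mxE (negPf ikj) andbF mul0r mulr0.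
by rewrite big1 ?mulr1 => [|k _]; last by rewrite ffunE mxE !eqxx.
Qed.

Theorem theorem2p8 (R : realType) (m n : nat)
    (m_gt0 : (0 < m)%N) (m_even : ~~ odd m) (n_gt0 : (0 < n)%N)
    (c c' : 'rV[R]_n) (C C' : tensor R m n)
    (cauchyC : is_cauchy_tensor c C) (cauchyC' : is_cauchy_tensor c' C')
    (posdefC : tensor_posdef C) (posdefC' : tensor_posdef C') :
  tensor_posdef (tensor_hadamard C C').
Proof.
(* The diagonal entry of [C'] at [j] is 1/(m c'_j). *)
have c'_gt0 j : 0 < c' ord0 j.
  have := posdef_diag_gt0 j posdefC'.
  rewrite cauchyC'.2 invr_gt0; under eq_bigr do rewrite ffunE.
  by rewrite sumr_const card_ord pmulrn_lgt0.
move=> x x0; rewrite /tensor_form.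
pose s (i : {ffun 'I_m -> 'I_n}) := \sum_(k < m) c' ord0 (i k).
have s_gt0 i : 0 < s i.
  rewrite /s (bigD1 (Ordinal m_gt0))//= ltr_pwDl// sumr_ge0// => k _.
  exact: ltW.
under eq_bigr do rewrite ffunE cauchyC'.2 mulrAC.
pose a i := C i * \prod_(k < m) x ord0 (i k).
apply: (@sum_div_gt0_of_exp_sum_gt0 _ _ s _ a) => // t.
pose y : 'rV[R]_n := \row_j (x ord0 j * expR (- c' ord0 j * t)).
have y0 : y != 0.
  apply: contra x0 => /eqP/rowP y0; apply/eqP/rowP => j; apply/eqP.
  by have /eqP := y0 j; rewrite !mxE mulf_eq0 [expR _ == 0]gt_eqF ?expR_gt0 ?orbF.
have := posdefC _ y0; rewrite /tensor_form; congr (_ < _).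
apply: eq_bigr => i _; rewrite -mulrA; congr (_ * _).
under eq_bigr do rewrite mxE.
(* The factors exp(-c'_{i_k} t) multiply over [k] to exp(-s_i t), which turns the form of [C] at [y]
   into the exponential sum at [t]. *)
rewrite big_split/= -expR_sum; congr (_ * expR _).
by rewrite -mulr_suml sumrN.
Qed.
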